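(* Let $(X,\succcurlyeq^X)$ be a partially ordered Banach space with dual space $X^*$ and $(Y,\succcurlyeq^Y)$ a partially ordered topological vector space with dual space $Y^*$. Let $C$ be a nonempty weakly compact subset of $X$ and $D$ a nonempty subset of $Y$. Let $f:C\to X^*$, $g:D\to Y^*$ and $A:X\to Y$ be (not necessarily linear) mappings. Suppose that the following conditions hold: (1) $f$ and $g$ are both order-positive; (2) for every $x\in C$, the set $m({}_fA_g)(x)$ is a nonempty weakly compact subset of $C$; (3) there are elements $x'\in C$ and $u'\in m({}_fA_g)(x')$ satisfying $x'\preccurlyeq^X u'$; (4) $A$ is order-increasing. Then the nonlinear split variational inequality problem $\mathrm{NSVI}(f,C,A,g,D)$ has a solution, and its solution set $\mathcal{S}(f,A,g)$ satisfies: (i) $(\mathcal{S}(f,A,g),\succcurlyeq^X)$ is a nonempty inductive poset; (ii) $(\mathcal{S}(f,A,g)\cap[x'),\succcurlyeq^X)$ is a nonempty inductive poset; (i)' $\mathrm{NSVI}(f,C,A,g,D)$ has an $\succcurlyeq^X$-maximal solution; (ii)' $\mathrm{NSVI}(f,C,A,g,D)$ has an $\succcurlyeq^X$-maximal solution $x^*$ with $x^*\succcurlyeq^X x'$.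
   Context: All vector spaces are real. A partially ordered topological vector space is a topological vector space $X$ with a partial order $\succcurlyeq$ such that: $x\succcurlyeq y$ implies $x+z\succcurlyeq y+z$ for all $x,y,z\in X$; $x\succcurlyeq y$ implies $\alpha x\succcurlyeq\alpha y$ for all $x,y\in X$ and real $\alpha\ge0$; and for every $u\in X$ the sets $[u)=\{x\in X:x\succcurlyeq u\}$ and $(u]=\{x\in X:x\preccurlyeq u\}$ are closed. Here $x\preccurlyeq y$ means $y\succcurlyeq x$. A partially ordered Banach space is a Banach space that is a partially ordered topological vector space for its norm topology. The dual $X^*$ is the space of continuous linear functionals on $X$, and $\langle\cdot,\cdot\rangle$ denotes the pairing between a space and its dual. A mapping $f:C\to X^*$, with $C\subseteq X$, is order-positive if, for all $x,y\in C$ with $x\preccurlyeq^X y$ and every $z\in X$, $\langle f(x),z\rangle\ge0$ implies $\langle f(y),z\rangle\ge 0$; order-positivity of $g:D\to Y^*$ is defined in the same way in $(Y,\succcurlyeq^Y)$. $A:X\to Y$ is order-increasing if $x\preccurlyeq^X y$ implies $Ax\preccurlyeq^Y Ay$. A poset is inductive if every (nonempty) chain in it has an upper bound in it. The problem $\mathrm{NSVI}(f,C,A,g,D)$ is: find $x_*\in C$ such that $\langle f(x_* ),x-x_*\rangle\ge0$ for all $x\in C$, and such that $y_*=Ax_*$ belongs to $D$ and satisfies $\langle g(y_* ),y-y_*\rangle\ge0$ for all $y\in D$. Such $x_*$ is a solution; $\mathcal{S}(f,A,g)\subseteq C$ is the set of solutions; an $\succcurlyeq^X$-maximal solution is a maximal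 element of $(\mathcal{S}(f,A,g),\succcurlyeq^X)$. For $x\in C$, $$m({}_fA_g)(x)=\{z\in C:\ \langle f(x),z\rangle=\min\{\langle f(x),t\rangle:t\in C\}\ \text{and}\ \langle g(Ax),Az\rangle=\min\{\langle g(Ax),s\rangle:s\in D\}\},$$ where the equalities include the requirement that the minima exist. Since $g$ is defined only on $D$, hypothesis (2) implicitly includes that $Ax\in D$ for every $x\in C$. *)

(* Defs.v *)
From HB Require Import structures.
From mathcomp Require Import all_boot all_order all_algebra.
From mathcomp Require Import all_classical all_reals all_analysis.

Set Implicit Arguments.
Unset Strict Implicit.
Unset Printing Implicit Defensive.

Import Order.TTheory GRing.Theory Num.Theory.
Import numFieldNormedType.Exports.

Local Open Scope classical_set_scope.
Local Open Scope ring_scope.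

(* The pairing between a space and its dual is application. *)
Record dual (R : realType) (X : topologicalLmodType R) := Dual {
  dual_fun :> {linear X -> R^o} ;
  dual_continuous : continuous (dual_fun : X -> R^o) }.

(* The coarsest topology making every continuous linear functional continuous. *)
Definition weak_topology (R : realType) (X : topologicalLmodType R)
    : topologicalType :=
  sup_topology (fun phi : dual X =>
    Topological.class (initial_topology (phi : X -> R^o))).

Definition weakly_compact (R : realType) (X : topologicalLmodType R)
    (C : set X) : Prop :=
  @compact (weak_topology X) C.

(* [le x y] is the partial order, read "x precedes y"; a topologicalLmodType is
   not assumed locally convex. *)
Record partially_ordered_tvs (R : realType) (X : topologicalLmodType R)
    (le : X -> X -> Prop) : Prop := {
  po_refl : forall x, le x x ;
  po_anti : forall x y, le x y -> le y x -> x = y ;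
  po_trans : forall x y z, le x y -> le y z -> le x z ;
  po_add : forall x y z, le y x -> le (y + z) (x + z) ;
  po_scale : forall x y (a : R), 0 <= a -> le y x -> le (a *: y) (a *: x) ;
  po_closed_up : forall u, closed [set x | le u x] ;
  po_closed_down : forall u, closed [set x | le x u] }.

(* The order of X is that of its norm topology. *)
Definition partially_ordered_banach (R : realType)
    (X : completeNormedModType R) (le : X -> X -> Prop) : Prop :=
  partially_ordered_tvs le.

(* Mappings with domain C (below, f on C and g on D) are represented by total
   functions whose values outside the domain are never used. *)
Definition order_positive (R : realType) (X : topologicalLmodType R)
    (le : X -> X -> Prop) (C : set X) (f : X -> dual X) : Prop :=
  forall x y, C x -> C y -> le x y -> forall z, 0 <= f x z -> 0 <= f y z.

Definition order_increasing (X Y : Type) (leX : X -> X -> Prop)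
    (leY : Y -> Y -> Prop) (A : X -> Y) : Prop :=
  forall x y, leX x y -> leY (A x) (A y).

Definition inductive_poset (X : Type) (le : X -> X -> Prop) (S : set X) : Prop :=
  forall K : set X, K `<=` S -> K !=set0 -> total_on K le ->
    exists2 u, S u & forall x, K x -> le x u.

Definition maximal_in (X : Type) (le : X -> X -> Prop) (S : set X) (x : X) : Prop :=
  S x /\ forall y, S y -> le x y -> y = x.

Definition is_minimum (R : realType) (E : set R) (v : R) : Prop :=
  E v /\ lbound E v.

Definition NSVI_sol (R : realType) (X Y : topologicalLmodType R)
    (f : X -> dual X) (C : set X) (A : X -> Y) (g : Y -> dual Y) (D : set Y)
    : set X :=
  [set x | [/\ C x, forall z, C z -> 0 <= f x (z - x),
               D (A x) & forall y, D y -> 0 <= g (A x) (y - A x)]].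

Definition min_set (R : realType) (X Y : topologicalLmodType R)
    (f : X -> dual X) (C : set X) (A : X -> Y) (g : Y -> dual Y) (D : set Y)
    (x : X) : set X :=
  [set z | [/\ C z,
     is_minimum [set (f x t : R) | t in C] (f x z) &
     is_minimum [set (g (A x) s : R) | s in D] (g (A x) (A z))]].

(* Main.v *)
Require Import Defs.
From HB Require Import structures.
From mathcomp Require Import all_boot all_order all_algebra.
From mathcomp Require Import all_classical all_reals all_analysis.
From mathcomp Require Import lra.

(** Call [T x] the set [min_set f C A g D x]. Saying that [z] minimizes [f x]
    over [C] is saying that [f x] is nonnegative on all the differences
    [t - z] with [t] in [C], and similarly for [g (A x)] over [D]. This has
    two consequences.

    - The solutions are exactly the points [x] with [x \in T x]
      ([NSVI_sol_fixpoint]).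
    - Order-positivity transports the nonnegativity from [x] to any larger
      [y], so [T x] is contained in [T y] when [x] precedes [y]
      ([min_set_mono]).

    Hence [u'], which lies in [T x'] and above [x'], lies in [T u']: it is a
    solution above [x'].

    For a nonempty chain [K] of solutions, the key fact is that a nonempty
    chain contained in a weakly compact set has a least upper bound, and that
    this bound lies in the set ([weakly_compact_chain_lub]). Let [c] be the
    least upper bound obtained from the compactness of [C]. Each [k] in [K]
    belongs to [T k], hence to [T c] by monotonicity; so the compactness of
    [T c] gives a least upper bound of [K] that lies in [T c]. Least upper
    bounds are unique, so [c] lies in [T c] and is a solution. Maximal
    solutions then come from Zorn's lemma.

    The least upper bound is a weak cluster point of the tails of the chain;
    it compares correctly with everything because order intervals unbounded
    on one side are weakly closed. That is Mazur's theorem for the positive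
    cone: two points not in order are separated by a continuous increasing
    linear functional ([order_separation]), an instance of the Hahn-Banach
    theorem. Here Hahn-Banach takes the form of a sandwich theorem
    ([sublinear_sandwich]), proved from the fact that the pointwise minimal
    sublinear functionals are linear. *)

Set Implicit Arguments.
Unset Strict Implicit.
Unset Printing Implicit Defensive.

Import Order.TTheory GRing.Theory Num.Theory.
Import numFieldNormedType.Exports.

Local Open Scope classical_set_scope.
Local Open Scope ring_scope.

(** * Maximal elements of inductive posets *)

(** Zorn's lemma for a subset of a poset, applied to the part of [S] that lies
    above [x0]: an element maximal there is maximal in [S]. *)
Lemma inductive_poset_maximal (T : Type) (le : T -> T -> Prop) (S : set T)
    (x0 : T) :
  (forall x, le x x) -> (forall x y z, le x y -> le y z -> le x z) ->
  (forall x y, le x y -> le y x -> x = y) ->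
  S x0 -> inductive_poset le S -> exists2 x, maximal_in le S x & le x0 x.
Proof.
move=> le_refl le_trans le_anti Sx0 indS.
pose U := {x | S x /\ le x0 x}.
pose leU (a b : U) := `[< le (sval a) (sval b) >].
have [|||K totK|[t [St x0t]] tmax] := @Zorn U leU.
- by move=> t; apply/asboolP.
- by move=> r s t /asboolP rs /asboolP st; apply/asboolP/(le_trans _ (sval s)).
- move=> [s ps] [t pt] /asboolP/= st /asboolP/= ts.
  by apply: eq_exist; exact: le_anti.
- have [->|/set0P[k0 Kk0]] := eqVneq K set0.
    by exists (exist _ x0 (conj Sx0 (le_refl x0))).
  have [_ [k Kk <-]|||u Su ubu] := indS (sval @` K).
  + by case: (svalP k).
  + by exists (sval k0), k0.
  + move=> _ _ [a Ka <-] [b Kb <-].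
    by case: (totK a b Ka Kb) => /asboolP; [left|right].
  + have x0u : le x0 u.
      by apply: (le_trans _ (sval k0)); [case: (svalP k0)|apply: ubu; exists k0].
    by exists (exist _ u (conj Su x0u)) => s Ks; apply/asboolP/ubu; exists s.
- exists t => //; split=> // y Sy ty.
  have := tmax (exist _ y (conj Sy (le_trans _ _ _ x0t ty))).
  by move=> /(_ (asboolT ty)) /(congr1 sval).
Qed.

(** * Sublinear functionals and the sandwich theorem *)

Section HahnBanach.
Variables (R : realType) (X : lmodType R).
Implicit Types (q s : X -> R) (K : X -> R -> Prop).

(** Homogeneity is only asked as an inequality, which is all that an infimum of
    such functionals inherits directly; [sublinear_scale] recovers equality. *)
Definition sublinear q :=
  (forall x y, q (x + y) <= q x + q y) /\
  (forall a x, 0 <= a -> q (a *: x) <= a * q x).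

Lemma sublinear0 q : sublinear q -> q 0 = 0.
Proof.
move=> [qD qZ]; apply/le_anti/andP; split.
  by have := qZ 0 0 (lexx _); rewrite scale0r mul0r.
by have := qD 0 0; rewrite addr0; lra.
Qed.

Lemma sublinear_geN q x : sublinear q -> - q (- x) <= q x.
Proof.
by move=> sq; have := sq.1 x (- x); rewrite subrr (sublinear0 sq); lra.
Qed.

Lemma sublinear_scale q a x : sublinear q -> 0 <= a -> q (a *: x) = a * q x.
Proof.
move=> sq; rewrite le_eqVlt => /predU1P[<-|a0].
  by rewrite scale0r mul0r sublinear0.
apply/le_anti/andP; split; first by apply: sq.2; exact: ltW.
rewrite -ler_pdivlMl//.
have := sq.2 a^-1 (a *: x); rewrite scalerA mulVf ?gt_eqF// scale1r.
by apply; rewrite invr_ge0 ltW.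
Qed.

(** The convex cone [K] of pairs (vector, height) plays the role of a partially
    defined superlinear functional below [s]. The functional
    [x |-> inf (s (x + k) - a)], with the infimum over the pairs [(k, a)] of
    [K], is bounded below by [- s (- x)] because [a <= s k]. It serves twice:
    to encode the constraint of the sandwich theorem, and, with a ray for [K],
    to show that minimal sublinear functionals are additive. *)
Lemma sublinear_infconv s K : sublinear s ->
  K 0 0 ->
  (forall x y a b, K x a -> K y b -> K (x + y) (a + b)) ->
  (forall t x a, 0 <= t -> K x a -> K (t *: x) (t * a)) ->
  (forall x a, K x a -> a <= s x) ->
  exists2 q, sublinear q & forall x k a, K k a -> q x <= s (x + k) - a.
Proof.
move=> ss K0 KD KZ Ks.
pose E x := [set s (x + p.1) - p.2 | p in [set p : X * R | K p.1 p.2]].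
have EK x k a : K k a -> E x (s (x + k) - a) by exists (k, a).
have E0 x : E x !=set0 by eexists; exact: EK K0.
have lbE x : has_lbound (E x).
  exists (- s (- x)) => _ [[k a]/= /Ks ask <-].
  by have := ss.1 (x + k) (- x); rewrite addrAC subrr add0r; lra.
have qle x k a : K k a -> inf (E x) <= s (x + k) - a.
  by move=> Kka; apply: ge_inf => //; exact: EK.
exists (fun x => inf (E x)) => //; split=> [x y|a x a0].
  rewrite -lerBlDr; apply: lb_le_inf => // _ [[k a]/= Kka <-].
  rewrite lerBlDr -lerBlDl; apply: lb_le_inf => // _ [[l b]/= Klb <-].
  have := qle (x + y) _ _ (KD _ _ _ _ Kka Klb).
  by have := ss.1 (x + k) (y + l); rewrite addrACA; lra.
have [->|] := eqVneq a 0.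
  rewrite scale0r mul0r; apply: le_trans (qle _ _ _ K0) _.
  by rewrite addr0 subr0 sublinear0.
move=> aneq0; have {}a0 : 0 < a by rewrite lt_def aneq0.
rewrite -ler_pdivrMl//; apply: lb_le_inf => // _ [[k b]/= Kkb <-].
rewrite ler_pdivrMl// mulrBr -(sublinear_scale _ ss (ltW a0)) scalerDr.
by apply: qle; apply: KZ => //; exact: ltW.
Qed.

(** Oriented so that the maximal elements are the pointwise minimal
    functionals. *)
Definition dominates q s := forall x, s x <= q x.

(** The pointwise infimum of a chain is finite: for [q] in the chain,
    comparability with a fixed member [q0] and [sublinear_geN] give
    [- q0 (- x) <= q x]. It is subadditive because a bound
    of the infimum at [x + y] by [q x + r y] follows from the subadditivity of
    the smaller of [q] and [r]. *)
Lemma sublinear_chain_inf : inductive_poset dominates sublinear.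
Proof.
move=> K Ksub [q0 Kq0] totK.
pose E x := [set q x | q in K].
have E0 x : E x !=set0 by exists (q0 x), q0.
have lbE x : has_lbound (E x).
  exists (- q0 (- x)) => _ [q Kq <-].
  have := sublinear_geN x (Ksub _ Kq); have := sublinear_geN x (Ksub _ Kq0).
  by case: (totK q q0 Kq Kq0) => d; have := d x; have := d (- x); lra.
have qle x q : K q -> inf (E x) <= q x.
  by move=> Kq; apply: ge_inf => //; exists q.
exists (fun x => inf (E x)); last by move=> q Kq x; exact: qle.
split=> [x y|a x a0].
  rewrite -lerBlDr; apply: lb_le_inf => // _ [q Kq <-].
  rewrite lerBlDr -lerBlDl; apply: lb_le_inf => // _ [r Kr <-].
  rewrite lerBlDl; case: (totK q r Kq Kr) => d.
    by have := qle (x + y) r Kr; have := (Ksub _ Kr).1 x y; have := d x; lra.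
  by have := qle (x + y) q Kq; have := (Ksub _ Kq).1 x y; have := d y; lra.
have [->|aneq0] := eqVneq a 0.
  rewrite scale0r mul0r; apply: le_trans (qle _ _ Kq0) _.
  by rewrite (sublinear0 (Ksub _ Kq0)).
have {}a0 : 0 < a by rewrite lt_def aneq0.
rewrite -ler_pdivrMl//; apply: lb_le_inf => // _ [q Kq <-].
rewrite ler_pdivrMl//; apply: le_trans (qle _ _ Kq) _.
by apply: (Ksub _ Kq).2; exact: ltW.
Qed.

(** Convolving [q] with the ray through [(y, q y)] yields a sublinear
    functional below [q], so [q] itself by minimality; the point of parameter 1
    on the ray then reads [q x <= q (x + y) - q y]. *)
Lemma minimal_sublinear_additive q :
  maximal_in dominates sublinear q -> forall x y, q (x + y) = q x + q y.
Proof.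
move=> [sq qmin] x y; apply/le_anti; rewrite sq.1/=.
pose K k a := exists t, [/\ 0 <= t, k = t *: y & a = t * q y].
have [||||r sr rle] := @sublinear_infconv q K sq.
- by exists 0; rewrite scale0r mul0r.
- move=> _ _ _ _ [t [t0 -> ->]] [u [u0 -> ->]]; exists (t + u).
  by rewrite scalerDl mulrDl addr_ge0.
- move=> u _ _ u0 [t [t0 -> ->]]; exists (u * t).
  by rewrite scalerA mulrA mulr_ge0.
- by move=> _ _ [t [t0 -> ->]]; rewrite sublinear_scale.
have rq : r = q.
  apply: qmin => // z; have := rle z 0 0; rewrite addr0 subr0; apply.
  by exists 0; rewrite scale0r mul0r.
have := rle x y (q y); rewrite rq lerBrDr; apply.
by exists 1; rewrite scale1r mul1r.
Qed.

(** A minimal sublinear functional below the infimal convolution of [s] with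
    the cone [K] is linear; it lies below [s] because [K] contains the origin,
    and above the heights in [K] because the convolution at [- x] is at most
    [- a]. *)
Lemma sublinear_sandwich s K : sublinear s ->
  K 0 0 ->
  (forall x y a b, K x a -> K y b -> K (x + y) (a + b)) ->
  (forall t x a, 0 <= t -> K x a -> K (t *: x) (t * a)) ->
  (forall x a, K x a -> a <= s x) ->
  exists phi : {linear X -> R^o},
    (forall x, (phi x : R) <= s x) /\ (forall x a, K x a -> a <= phi x).
Proof.
move=> ss K0 KD KZ Ks.
have [p sp ple] := sublinear_infconv ss K0 KD KZ Ks.
have [|||q qmax pq] :=
  @inductive_poset_maximal _ dominates sublinear p _ _ _ sp sublinear_chain_inf.
- by move=> q x.
- by move=> q r u qr ru x; exact: le_trans (ru x) (qr x).
- by move=> q r qr rq; apply/funext => x; apply/le_anti; rewrite qr rq.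
have qD := minimal_sublinear_additive qmax.
have sq := qmax.1.
have qN x : q (- x) = - q x.
  by have := qD x (- x); rewrite subrr sublinear0//; lra.
have qlin : linear (q : X -> R^o).
  move=> a x y; rewrite qD; congr (_ + _).
  have [a0|a0] := leP 0 a; first by rewrite sublinear_scale.
  rewrite -[a]opprK scaleNr qN sublinear_scale ?oppr_ge0 1?ltW//.
  by rewrite scaleNr.
pose Q := GRing.isLinear.Build R X R^o *:%R q qlin.
pose phi : {linear X -> R^o} := HB.pack (q : X -> R^o) Q.
exists phi; split=> x.
  by apply: le_trans (pq x) _; have := ple x 0 0 K0; rewrite addr0 subr0.
move=> a Kxa; have := ple (- x) x a Kxa; rewrite addNr sublinear0//.
by have := pq (- x); rewrite /phi/= qN; lra.
Qed.

End HahnBanach.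

(** * Weak closedness of one-sided order intervals *)

(** Put [x := b - a], which is not positive, hence at distance at least some
    [d > 0] from the closed cone of positive vectors. The sandwich theorem
    under the norm yields a functional that is nonnegative on that cone and at
    least [d] at [- x]; being dominated by the norm, it is continuous. *)
Lemma order_separation (R : realType) (X : normedModType R)
    (le : X -> X -> Prop) (a b : X) :
  partially_ordered_tvs le -> ~ le a b ->
  exists2 phi : dual X,
    (forall x y, le x y -> (phi x : R) <= phi y) & (phi b : R) < phi a.
Proof.
move=> po nab.
have posD x y : le 0 x -> le 0 y -> le 0 (x + y).
  move=> x0 y0; apply: (po_trans po y0).
  by have := po_add po y x0; rewrite add0r.
have posZ t x : 0 <= t -> le 0 x -> le 0 (t *: x).
  by move=> t0 x0; have := po_scale po t0 x0; rewrite scaler0.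
have sub_pos x y : le 0 (y - x) -> le x y.
  by move=> xy; have := po_add po x xy; rewrite add0r subrK.
have pos_sub x y : le x y -> le 0 (y - x).
  by move=> xy; have := po_add po (- x) xy; rewrite subrr.
pose x := b - a.
have [d d0 dP] : exists2 d : R, 0 < d & forall y, le 0 y -> d <= `|y - x|.
  have nx : (~` [set y | le 0 y]) x by move=> /sub_pos.
  have := open_nbhs_nbhs (conj (closed_openC (@po_closed_up _ _ _ po 0)) nx).
  move=> /nbhs_ballP[d /= d0 dP]; exists d => // y y0.
  rewrite leNgt; apply/negP => yx; apply: (dP y) => //.
  by rewrite -ball_normE/= distrC.
(* The cone generated by the pairs [(y, 0)], [y] positive, and [(- x, d)]. *)
pose K k r := exists y t, [/\ le 0 y, 0 <= t, k = y - t *: x & r = t * d].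
have [|||||phi [phin phiK]] := @sublinear_sandwich R X (fun y => `|y|) K.
- split=> [y z|t y t0]; first exact: ler_normD.
  by rewrite normrZ ger0_norm.
- by exists 0, 0; split=> //; rewrite ?scale0r ?subr0 ?mul0r//; exact: po_refl.
- move=> _ _ _ _ [y [t [y0 t0 -> ->]]] [z [u [z0 u0 -> ->]]].
  exists (y + z), (t + u); split; rewrite ?addr_ge0 ?mulrDl//; first exact: posD.
  by rewrite scalerDl opprD addrACA.
- move=> u _ _ u0 [y [t [y0 t0 -> ->]]].
  exists (u *: y), (u * t); split; rewrite ?mulr_ge0 ?mulrA//; first exact: posZ.
  by rewrite scalerBr scalerA.
- move=> _ _ [y [t [y0 + -> ->]]].
  rewrite le_eqVlt => /predU1P[<-|t0]; first by rewrite mul0r.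
  have -> : y - t *: x = t *: (t^-1 *: y - x).
    by rewrite [RHS]scalerBr scalerA divff ?gt_eqF// scale1r.
  rewrite normrZ gtr0_norm// ler_pM2l//; apply/dP/posZ => //.
  by rewrite invr_ge0 ltW.
have phic : continuous (phi : X -> R^o).
  apply/bounded_linear_continuous/linear_boundedP; near=> r => y.
  have {}phin : `|phi y| <= `|y|.
    rewrite ler_norml phin andbT lerNl -linearN.
    by apply: le_trans (phin _) _; rewrite normrN.
  apply: le_trans phin _; rewrite ler_peMl//.
exists (Dual phic) => /=.
  move=> y z /pos_sub yz; rewrite -subr_ge0 -linearB; apply: phiK.
  by exists (z - y), 0; rewrite scale0r subr0 mul0r.
rewrite -subr_gt0 -linearB; apply: (lt_le_trans d0); apply: phiK.
exists 0, 1; split=> //; rewrite ?scale1r ?mul1r//; first exact: po_refl.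
by rewrite /x opprB add0r.
Unshelve. all: by end_near. Qed.

Section WeakTopology.
Variables (R : realType) (X : normedModType R).

Lemma weak_dual_continuous (phi : dual X) :
  continuous (phi : weak_topology X -> R^o).
Proof.
move=> x; have xx : nbhs (x : weak_topology X) --> (x : weak_topology X).
  exact: cvg_id.
have /= xphi := (cvg_sup _ _ _).1 xx phi.
move=> U /(@initial_continuous X R^o phi x); exact: xphi.
Qed.

Lemma weakly_closed_preimage (phi : dual X) (P : set R) :
  closed P -> @closed (weak_topology X) (phi @^-1` P).
Proof.
by move=> cP; apply: closed_comp cP => x _; exact: weak_dual_continuous.
Qed.

(** The one-sided interval is the intersection of the half-spaces given by the
    increasing continuous functionals, each of which is weakly closed. *)
Lemma weakly_closed_up (le : X -> X -> Prop) u : partially_ordered_tvs le ->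
  @closed (weak_topology X) [set x | le u x].
Proof.
move=> po x ux; apply: contrapT => /(order_separation po)[phi mono].
apply/negP; rewrite -leNgt.
apply: (weakly_closed_preimage (@closed_ge R (phi u))).
by apply: closure_subset ux => y /mono.
Qed.

Lemma weakly_closed_down (le : X -> X -> Prop) u : partially_ordered_tvs le ->
  @closed (weak_topology X) [set x | le x u].
Proof.
move=> po x ux; apply: contrapT => /(order_separation po)[phi mono].
apply/negP; rewrite -leNgt.
apply: (weakly_closed_preimage (@closed_le R (phi u))).
by apply: closure_subset ux => y /mono.
Qed.

(** Any weak cluster point [c] of the tails of [K] works: [c] is above [k]
    because the tail from [k] lies in the weakly closed set of points above
    [k], and below any upper bound [u] because [K] lies in the weakly closed
    set of points below [u]. *)
Lemma weakly_compact_chain_lub (le : X -> X -> Prop) (B K : set X) :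
  partially_ordered_tvs le -> weakly_compact B ->
  K `<=` B -> K !=set0 -> total_on K le ->
  exists c, [/\ B c, forall k, K k -> le k c &
                forall u, (forall k, K k -> le k u) -> le c u].
Proof.
move=> po Bcpt KB [k0 Kk0] totK.
pose tail k := [set y | K y /\ le k y].
pose F : set_system (weak_topology X) := filter_from K tail.
have FF : Filter F.
  apply: filter_from_filter; first by exists k0.
  move=> i j Ki Kj; case: (totK i j Ki Kj) => ij.
    by exists j => // y [Ky jy]; do 2!split=> //; exact: po_trans jy.
  by exists i => // y [Ky iy]; do 2!split=> //; exact: po_trans iy.
have PF : ProperFilter F.
  by apply: filter_from_proper => // i Ki; exists i; split=> //; exact: po_refl.
have [|c [Bc]] := Bcpt F PF; first by exists k0 => // y [/KB].
rewrite clusterE => Fc.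
have tc k : K k -> @closure (weak_topology X) (tail k) c.
  by move=> Kk; apply: Fc; exists k.
exists c; split=> // [k Kk|u Ku].
  by apply: weakly_closed_up => //; apply: closure_subset (tc k Kk) => y [].
apply: weakly_closed_down => //.
by apply: closure_subset (tc k0 Kk0) => y [/Ku].
Qed.

End WeakTopology.

(** * Solutions as fixed points of a monotone set-valued map *)

Section Solutions.
Variables (R : realType) (X Y : topologicalLmodType R).
Variables (f : X -> dual X) (C : set X) (A : X -> Y) (g : Y -> dual Y).
Variable D : set Y.

Lemma is_minimum_image (Z : topologicalLmodType R) (phi : dual Z)
    (E : set Z) (z : Z) : E z ->
  is_minimum [set (phi t : R) | t in E] (phi z) <->
  forall t, E t -> 0 <= phi (t - z).
Proof.
move=> Ez; split=> [[_ lb] t Et|pos].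
  by rewrite linearB subr_ge0; apply: lb; exists t.
split; first by exists z.
by move=> _ [t Et <-]; rewrite -subr_ge0 -linearB; exact: pos.
Qed.

Hypothesis AD : forall x, C x -> D (A x).

(** The minimum over [D] is required to be attained at [A z], and [A z] lies in
    [D] since [A] maps [C] to [D]; so both conditions become variational
    inequalities based at [z]. *)
Lemma min_setP x z : C z ->
  min_set f C A g D x z <->
  (forall t, C t -> 0 <= f x (t - z)) /\
  (forall y, D y -> 0 <= g (A x) (y - A z)).
Proof.
move=> Cz; have fP := is_minimum_image (f x) Cz.
have gP := is_minimum_image (g (A x)) (AD Cz).
by split=> [[_ /fP + /gP]|[/fP + /gP]].
Qed.

Lemma NSVI_sol_fixpoint x : NSVI_sol f C A g D x <-> min_set f C A g D x x.
Proof.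
split=> [[Cx fx _ gx]|mx]; first exact/min_setP.
have Cx : C x by case: mx.
by have [fx gx] := (min_setP x Cx).1 mx; split=> //; exact: AD.
Qed.

(** Order-positivity is applied to the displacements [t - z] from [z], on which
    the functional at [x] is nonnegative. *)
Lemma min_set_mono leX leY x y : order_positive leX C f ->
  order_positive leY D g -> order_increasing leX leY A ->
  C x -> C y -> leX x y -> min_set f C A g D x `<=` min_set f C A g D y.
Proof.
move=> hf hg hA Cx Cy xy z mz; have Cz : C z by case: mz.
have [fz gz] := (min_setP x Cz).1 mz; apply/min_setP => //; split=> t Et.
  exact: hf xy _ (fz t Et).
apply: (hg _ _ (AD Cx) (AD Cy)) (gz t Et); exact: hA.
Qed.

End Solutions.

Theorem corollary3p4 (R : realType)
  (X : completeNormedModType R) (leX : X -> X -> Prop)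
  (Y : topologicalLmodType R) (leY : Y -> Y -> Prop)
  (C : set X) (D : set Y)
  (f : X -> dual X) (g : Y -> dual Y) (A : X -> Y) (x' u' : X)
  (hX : partially_ordered_banach leX) (hY : partially_ordered_tvs leY)
  (hC0 : C !=set0) (hC : weakly_compact C) (hD0 : D !=set0)
  (hf : order_positive leX C f) (hg : order_positive leY D g)
  (hAD : forall x, C x -> D (A x))
  (hm : forall x, C x ->
     min_set f C A g D x !=set0 /\ weakly_compact (min_set f C A g D x))
  (hx' : C x') (hu' : min_set f C A g D x' u') (hxu : leX x' u')
  (hA : order_increasing leX leY A) :
  let S := NSVI_sol f C A g D in
  let Sx' := S `&` [set x | leX x' x] in
  S !=set0 /\
  [/\ S !=set0 /\ inductive_poset leX S,
      Sx' !=set0 /\ inductive_poset leX Sx',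
      exists x, maximal_in leX S x &
      exists2 x, maximal_in leX S x & leX x' x].
Proof.
move=> S Sx'.
have mono x y : C x -> C y -> leX x y ->
    min_set f C A g D x `<=` min_set f C A g D y.
  exact: (min_set_mono hAD hf hg hA).
have solP := NSVI_sol_fixpoint f g hAD.
have Cu' : C u' by case: hu'.
have Su' : S u' by apply/solP/(mono x').
have indS : inductive_poset leX S.
  move=> K KS K0 totK.
  have KC : K `<=` C by move=> k /KS[].
  have [c [Cc cub club]] := weakly_compact_chain_lub hX hC KC K0 totK.
  have KT : K `<=` min_set f C A g D c.
    by move=> k Kk; apply: (mono k c (KC _ Kk) Cc (cub _ Kk)); apply/solP/KS.
  (* A second least upper bound of [K], which this time is known to be a minimizer
     for [c]. *)
  have [d [Td dub dlub]] :=
    weakly_compact_chain_lub hX (hm _ Cc).2 KT K0 totK.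
  exists c => //; apply/solP.
  by rewrite (po_anti hX (club _ dub) (dlub _ cub)) in Td *.
have Sx'u' : Sx' u' by split.
have indSx' : inductive_poset leX Sx'.
  move=> K KSx' [k Kk] totK.
  have [||u Su uub] := indS K _ _ totK; first by move=> z /KSx'[].
    by exists k.
  exists u => //; split=> //=.
  by apply: (po_trans hX _ (uub _ Kk)); case: (KSx' _ Kk).
have [x xmax u'x] := inductive_poset_maximal (po_refl hX)
  (@po_trans _ _ _ hX) (@po_anti _ _ _ hX) Su' indS.
split; first by exists u'.
split; [by split; [exists u'|] | by split; [exists u'|] | by exists x |].
by exists x => //; exact: po_trans hxu u'x.
Qed.
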